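(* Let $n\ge 1$ and $k$ be positive integers and let $\lambda$ be a partition of length at most $n$. Then, as polynomials in $x_1,\dots,x_n$ with coefficients in $\mathbb{Z}[\beta]$, \[ G_\lambda\, p_k \;=\; \sum_{\mu}(-\beta)^{|\mu/\lambda|-k}\,(-1)^{k-c(\mu/\lambda)}\binom{r(\mu/\lambda)-1}{k-c(\mu/\lambda)}\,G_{\mu}, \] where the sum runs over all partitions $\mu$ of length at most $n$ with $\mu\geq\lambda$ such that $c(\mu/\lambda)\le k$, the skew shape $\mu/\lambda$ is connected, and the maximal ribbon along the northwest border of $\mu/\lambda$ has size at least $k$.
   Context: $\beta$ is a formal parameter. For a partition $\lambda=(\lambda_1\ge\dots\ge\lambda_n\ge 0)$ of length at most $n$, the Grassmannian Grothendieck polynomial in $n$ variables is \[G_\lambda=\frac{\det\big(x_i^{\lambda_j+n-j}(1+\beta x_i)^{j-1}\big)_{1\le i,j\le n}}{\prod_{1\le i<j\le n}(x_i-x_j)}.\] $p_k=\sum_{i=1}^n x_i^k$ is the $k$-th power sum symmetric polynomial. For partitions $\lambda,\mu$, $\lambda\le\mu$ means $\lambda_i\le\mu_i$ for all $i$; the skew (Young) diagram $\mu/\lambda$ consists of the boxes of the Young diagram of $\mu$ not in that of $\lambda$. $|\mu/\lambda|=|\mu|-|\lambda|$ is its number of boxes, and $r(\mu/\lambda)$, $c(\mu/\lambda)$ are the numbers of rows, respectively columns, that contain at least one box of $\mu/\lambda$. Two boxes are adjacent if they share an edge; $\mu/\lambda$ is connected if any two of its boxes are joined by a sequence of adjacent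 boxes. A ribbon is a connected skew shape containing no $2\times 2$ square. For connected $\mu/\lambda$, the maximal ribbon along the northwest border of $\mu/\lambda$ is the ribbon $\nu/\lambda$ of largest possible size contained in $\mu/\lambda$ (with $\lambda\le\nu\le\mu$). *)

(* Defs.v *)
From HB Require Import structures.
From mathcomp Require Import all_boot all_order all_algebra.
From mathcomp Require Import mpoly.
From mathcomp Require Import boolp classical_sets functions cardinality fsbigop.

Set Implicit Arguments.
Unset Strict Implicit.
Unset Printing Implicit Defensive.

Import GRing.Theory.
Local Open Scope ring_scope.

(* A partition of length at most n is a weakly decreasing n-tuple of naturals;
   rows, columns and parts are all numbered from 0. *)
Definition is_partition (n : nat) (lam : n.-tuple nat) : bool := sorted geq lam.

Definition part_le (n : nat) (lam mu : n.-tuple nat) : bool :=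
  [forall i, (tnth lam i <= tnth mu i)%N].

Definition young (n : nat) (lam : n.-tuple nat) : seq (nat * nat) :=
  [seq (i, j) | i <- iota 0 n, j <- iota 0 (nth 0%N lam i)].

Definition skew_shape (n : nat) (mu lam : n.-tuple nat) : seq (nat * nat) :=
  [seq b <- young mu | b \notin young lam].

Definition nrows (D : seq (nat * nat)) : nat := size (undup [seq b.1 | b <- D]).
Definition ncols (D : seq (nat * nat)) : nat := size (undup [seq b.2 | b <- D]).

Definition adjacent (a b : nat * nat) : bool :=
  (a.1 == b.1) && ((a.2 == b.2.+1) || (b.2 == a.2.+1)) ||
  (a.2 == b.2) && ((a.1 == b.1.+1) || (b.1 == a.1.+1)).

Definition connected_shape (D : seq (nat * nat)) : Prop :=
  forall a b, a \in D -> b \in D ->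
  exists p : seq (nat * nat),
    [/\ path adjacent a p, {subset p <= D} & last a p = b].

Definition has_square (D : seq (nat * nat)) : Prop :=
  exists i j : nat,
    [/\ (i, j) \in D, (i, j.+1) \in D, (i.+1, j) \in D & (i.+1, j.+1) \in D].

Definition is_ribbon (D : seq (nat * nat)) : Prop :=
  connected_shape D /\ ~ has_square D.

Definition sub_ribbon (n : nat) (mu lam nu : n.-tuple nat) : Prop :=
  [/\ is_partition nu, part_le lam nu, part_le nu mu
    & is_ribbon (skew_shape nu lam)].

Definition is_max_ribbon (n : nat) (mu lam nu : n.-tuple nat) : Prop :=
  sub_ribbon mu lam nu /\
  forall nu', sub_ribbon mu lam nu' ->
    (size (skew_shape nu' lam) <= size (skew_shape nu lam))%N.

(* For k > 0 every mu in this set has |mu/lam| >= k, hence r(mu/lam) >= 1, and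
   c(mu/lam) <= k, so natural subtraction never truncates in the exponents
   |mu/lam| - k, k - c(mu/lam) and in r(mu/lam) - 1.  The empty shape counts
   as a ribbon of size 0; it is excluded by the last condition. *)
Definition pieri_set (n k : nat) (lam : n.-tuple nat) : set (n.-tuple nat) :=
  [set mu | [/\ is_partition mu, part_le lam mu,
                (ncols (skew_shape mu lam) <= k)%N,
                connected_shape (skew_shape mu lam) &
                exists nu, is_max_ribbon mu lam nu /\
                           (k <= size (skew_shape nu lam))%N]]%classic.

(* Coefficients lie in Z[beta] = {poly int}. *)
Definition beta : {poly int} := 'X.

Definition vandermonde (n : nat) : {mpoly {poly int}[n]} :=
  \prod_(i < n) \prod_(j < n | (i < j)%N) ('X_i - 'X_j).

(* With 0-based j, the exponents lam_j + n - j and j - 1 become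
   lam_j + (n - j.+1) and j. *)
Definition groth_num (n : nat) (lam : n.-tuple nat) : {mpoly {poly int}[n]} :=
  \det (\matrix_(i < n, j < n)
          ('X_i ^+ (tnth lam j + (n - j.+1)) * (1 + beta%:MP * 'X_i) ^+ j)).

Lemma det_horner_dvd (R : comNzRingType) (n : nat) (f : 'I_n -> {poly R})
    (x : 'I_n -> R) :
  exists g, g * \prod_(i < n) \prod_(j < n | (i < j)%N) (x i - x j)
            = \det (\matrix_(i, j) (f j).[x i]).
Proof.
elim: n f x => [|n IHn] f x; first by exists 1; rewrite det_mx00 big_ord0 mulr1.
have fac j : exists q, f j - (f j).[x 0]%:P = q * ('X - (x 0)%:P).
  by apply/factor_theorem; rewrite /root !hornerE subrr.
have /fin_all_exists[q qE] := fac.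
have {fac}qx j y : (f j).[y] = (f j).[x 0] + (q j).[y] * (y - x 0).
  have /(congr1 (fun p => p.[y])) := qE j.
  by rewrite !hornerE => <-; rewrite addrC subrK.
pose E : 'M[R]_n.+1 := \matrix_(i, j)
  (if j == 0 then 1 else if i == j then x 0 - x i else 0).
pose M : 'M[R]_n.+1 := \matrix_(i, j)
  (if i == 0 then (f j).[x 0] else - (q j).[x i]).
have ME : \matrix_(i, j) (f j).[x i] = E *m M.
  apply/matrixP=> i j; rewrite !mxE big_ord_recl !mxE /= mul1r.
  case: (unliftP 0 i) => [i'|] ->.
    rewrite (bigD1 i') //= !mxE eqxx /= big1 => [|l li].
      by rewrite addr0 qx mulrN mulrC -mulNr opprB.
    by rewrite !mxE (inj_eq lift_inj) [i' == l]eq_sym (negbTE li) mul0r.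
  by rewrite big1 ?addr0 // => l _; rewrite !mxE /= mul0r.
have detE : \det E = \prod_(i < n) (x 0 - x (lift 0 i)).
  rewrite det_trig; last first.
    apply/is_trig_mxP=> i j ij; rewrite !mxE.
    by rewrite -!val_eqE /= (ltn_eqF ij); case: (val j) ij.
  rewrite big_ord_recl !mxE /= mul1r; apply: eq_bigr => i _.
  by rewrite !mxE /= eqxx.
have minor j : exists g, g * \prod_(i < n) \prod_(l < n | (i < l)%N)
      (x (lift 0 i) - x (lift 0 l)) = \det (row' 0 (col' j M)).
  have [g gE] := IHn (fun l => - q (lift j l)) (fun i => x (lift 0 i)).
  exists g; rewrite gE; congr (\det _); apply/matrixP=> i l.
  by rewrite !mxE /= hornerN.
have /fin_all_exists[g gE] := minor.
exists (\sum_j M 0 j * ((-1) ^+ (0 + j) * g j)).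
rewrite ME det_mulmx detE (expand_det_row M 0) [RHS]mulrC big_ord_recl /=.
have -> : \prod_(j < n.+1 | (0 < j)%N) (x 0 - x j)
        = \prod_(i < n) (x 0 - x (lift 0 i)).
  by rewrite big_mkcond big_ord_recl /= mul1r.
rewrite mulrA mulrAC; congr (_ * _); rewrite mulr_suml.
apply: eq_bigr => j _; rewrite /cofactor -gE -!mulrA; congr (_ * (_ * (_ * _))).
by apply: eq_bigr => i _; rewrite big_mkcond big_ord_recl /= mul1r -big_mkcond.
Qed.

Lemma vandermonde_neq0 (n : nat) : vandermonde n != 0.
Proof.
apply/prodf_neq0 => i _; apply/prodf_neq0 => j ij; rewrite subr_eq0.
apply/eqP => /(congr1 (mcoeff U_(i)%MM)) /eqP.
by rewrite !mcoeffXU eqxx; case: (j =P i) ij => [->|_]; rewrite ?ltnn ?oner_eq0.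
Qed.

Lemma groth_num_dvd (n : nat) (lam : n.-tuple nat) :
  exists g, g * vandermonde n == groth_num lam.
Proof.
pose f (j : 'I_n) : {poly {mpoly {poly int}[n]}} :=
  'X ^+ (tnth lam j + (n - j.+1)) * (1 + (beta%:MP)%:P * 'X) ^+ j.
have [g gE] := det_horner_dvd f (fun i => 'X_i).
exists g; rewrite /vandermonde gE; apply/eqP; congr (\det _).
by apply/matrixP => i j; rewrite !mxE /f !hornerE.
Qed.

(* The quotient groth_num lam / vandermonde n, as an actual polynomial. *)
Definition grothendieck (n : nat) (lam : n.-tuple nat) : {mpoly {poly int}[n]} :=
  xchoose (groth_num_dvd lam).

Lemma grothendieckP (n : nat) (lam : n.-tuple nat) :
  grothendieck lam * vandermonde n = groth_num lam.
Proof. exact/eqP/(xchooseP (groth_num_dvd lam)). Qed.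

Lemma grothendieck_uniq (n : nat) (lam : n.-tuple nat) g :
  g * vandermonde n = groth_num lam -> g = grothendieck lam.
Proof. by rewrite -grothendieckP; apply: mulIf (vandermonde_neq0 n) _ _. Qed.

Definition power_sum (n k : nat) : {mpoly {poly int}[n]} :=
  \sum_(i < n) 'X_i ^+ k.

Lemma mem_young (n : nat) (lam : n.-tuple nat) (i j : nat) :
  ((i, j) \in young lam) = (i < n)%N && (j < nth 0%N lam i)%N.
Proof.
apply/allpairsPdep/idP => [[a [b [+ + [-> ->]]]]|/andP[lin ljm]].
  by rewrite !mem_iota /= !add0n => -> ->.
by exists i, j; rewrite !mem_iota /= !add0n.
Qed.

Lemma mem_skew_shape (n : nat) (mu lam : n.-tuple nat) (i j : nat) :
  ((i, j) \in skew_shape mu lam) =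
  [&& (i < n)%N, (nth 0%N lam i <= j)%N & (j < nth 0%N mu i)%N].
Proof.
rewrite mem_filter !mem_young negb_and -!leqNgt.
by case: (ltnP i n) => //= _; rewrite andbC andbC.
Qed.

Lemma skew_shape_ncols (n : nat) (mu lam : n.-tuple nat) (i : 'I_n) :
  (tnth mu i <= tnth lam i + ncols (skew_shape mu lam))%N.
Proof.
rewrite -leq_subLR -[leqLHS](size_iota (tnth lam i)).
apply: uniq_leq_size (iota_uniq _ _) _ => j; rewrite mem_iota => /andP[lj jm].
rewrite mem_undup; apply/mapP; exists (val i, j) => //.
rewrite mem_skew_shape ltn_ord -!tnth_nth lj /=.
by case: (leqP (tnth lam i) (tnth mu i)) jm lj => [/subnKC->|/ltnW/eqP->] //;
  rewrite addn0 ltnNge => /negP.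
Qed.

(* Makes the finitely supported sum over pieri_set a genuine sum. *)
Lemma finite_pieri_set (n k : nat) (lam : n.-tuple nat) :
  finite_set (pieri_set k lam).
Proof.
pose F (t : n.-tuple 'I_(sumn lam + k).+1) := [tuple of map val t].
apply: (@sub_finite_set _ _ (F @` [set: _])%classic); last first.
  exact/finite_image/finite_finset.
move=> mu [_ _ cmu _ _] /=.
exists [tuple inord (tnth mu i) | i < n] => //.
apply: eq_from_tnth => i; rewrite tnth_map tnth_mktuple /= inordK // ltnS.
apply: leq_trans (skew_shape_ncols mu lam i) _; apply: leq_add cmu.
by rewrite sumnE big_tuple (bigD1 i) //= leq_addr.
Qed.

(* Main.v *)
Require Import Defs.
From mathcomp Require Import all_boot all_order all_algebra.
From mathcomp Require Import mpoly.
From mathcomp Require Import boolp classical_sets functions cardinality fsbigop.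
From mathcomp Require Import zify ring.

(* Write D(mu) for the numerator determinant of G_mu.  Multiplying D(lam) by p_k
   gives the sum over j of the determinants obtained from D(lam) by raising the
   exponent lam_j to lam_j + k.  Scaled by (-beta)^a, the columns
   F_l(a) = (-beta x)^a x^(n-l) (1 + beta x)^(l-1) satisfy
   F_{l+1}(a) = beta (F_l(a) - F_l(a-1)).
   (1) Fix rows i <= j and a top part b.  The sum of (-beta)^|mu| D(mu) over the
   mu with lam_{l-1} < mu_l <= mu_{l-1} for i < l <= j, mu_i = b, and mu = lam
   elsewhere telescopes from the bottom row up, to beta^(j-i) times the scaled
   D(lam) with its column j replaced by F_i(b).
   (2) F_j(lam_j + k) is the iterated difference
   beta^(j-i) sum_d (-1)^d binom(j-i, d) F_i(lam_j + k - d).  Changing i to i + 1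
   in a truncation of this sum at parts larger than lam_i alters it by a multiple
   of F_i(lam_i), which is already a column; so F_j(lam_j + k) may be replaced by
   the sum over i of the terms with lam_i < lam_j + k - d <= lam_{i-1}.
   The pairs (i, mu) so obtained are the connected shapes mu/lam with bottom row
   j, and d = k - c(mu/lam).  The ribbon condition k <= r + c - 1 only discards
   terms with a vanishing binomial coefficient. *)

Import GRing.Theory.
Local Open Scope ring_scope.

Set Implicit Arguments.
Unset Strict Implicit.
Unset Printing Implicit Defensive.

(** * Determinants as functions of their rows *)

(** Rows are indexed by all naturals, so that index arithmetic needs no bounds; only rows below [n]
    count. The columns of the numerator determinant become rows here. *)
Definition rowdet {R : comNzRingType} {n : nat} (g : nat -> 'rV[R]_n) : R :=
  \det (\matrix_(l < n) g l).

Definition upd {T : Type} (g : nat -> T) (i : nat) (v : T) (l : nat) : T :=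
  if l == i then v else g l.

Section RowDet.
Variables (R : comNzRingType) (n : nat).
Implicit Types (g : nat -> 'rV[R]_n) (u v : 'rV[R]_n).

Lemma eq_rowdet g g' :
  (forall l, (l < n)%N -> g l = g' l) -> rowdet g = rowdet g'.
Proof.
by move=> gg'; congr (\det _); apply/matrixP=> l c; rewrite !mxE gg'.
Qed.

Lemma rowdet_updD g i u v : (i < n)%N ->
  rowdet (upd g i (u + v)) = rowdet (upd g i u) + rowdet (upd g i v).
Proof.
move=> lin.
rewrite -[rowdet (upd g i u)]mul1r -[rowdet (upd g i v)]mul1r.
apply: (@determinant_multilinear _ _ _ _ _ (Ordinal lin));
  rewrite ?scale1r.
- by rewrite !rowK /upd eqxx.
- apply/matrixP=> l c; rewrite !mxE /upd.
  by have := neq_lift (Ordinal lin) l; rewrite -val_eqE /= eq_sym => /negbTE->.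
apply/matrixP=> l c; rewrite !mxE /upd.
by have := neq_lift (Ordinal lin) l; rewrite -val_eqE /= eq_sym => /negbTE->.
Qed.

Lemma rowdet_updZ g i a v : (i < n)%N ->
  rowdet (upd g i (a *: v)) = a * rowdet (upd g i v).
Proof.
move=> lin; rewrite -[RHS]addr0 -[X in _ + X](mul0r (rowdet (upd g i v))).
apply: (@determinant_multilinear _ _ _ _ _ (Ordinal lin)).
- by rewrite !rowK /upd eqxx scale0r addr0.
- apply/matrixP=> l c; rewrite !mxE /upd.
  by have := neq_lift (Ordinal lin) l; rewrite -val_eqE /= eq_sym => /negbTE->.
apply/matrixP=> l c; rewrite !mxE /upd.
by have := neq_lift (Ordinal lin) l; rewrite -val_eqE /= eq_sym => /negbTE->.
Qed.

Lemma rowdet_updB g i u v : (i < n)%N ->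
  rowdet (upd g i (u - v)) = rowdet (upd g i u) - rowdet (upd g i v).
Proof.
by move=> lin; rewrite rowdet_updD // -scaleN1r rowdet_updZ // mulN1r.
Qed.

Lemma rowdet_upd_sum (I : Type) (r : seq I) (P : pred I) (f : I -> 'rV[R]_n) g i :
  (i < n)%N ->
  rowdet (upd g i (\sum_(x <- r | P x) f x)) =
  \sum_(x <- r | P x) rowdet (upd g i (f x)).
Proof.
move=> lin; apply: (big_morph (fun v => rowdet (upd g i v))) => [u v|].
  exact: rowdet_updD.
by rewrite -(scale0r 0) rowdet_updZ // mul0r.
Qed.

Lemma rowdet_alternate g i j :
  (i < n)%N -> (j < n)%N -> i != j -> g i = g j -> rowdet g = 0.
Proof.
move=> lin ljn ij gij; apply: (@determinant_alternate _ _ _ (Ordinal lin) (Ordinal ljn)) => //.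
by move=> c; rewrite !mxE /= gij.
Qed.

Lemma rowdet_scale_rows (c : nat -> R) g :
  rowdet (fun l => c l *: g l) = (\prod_(l < n) c l) * rowdet g.
Proof.
pose d : 'rV[R]_n := \row_(l < n) c l.
rewrite /rowdet -[X in X * _](_ : \det (diag_mx d) = _); last first.
  by rewrite det_diag; apply: eq_bigr => l _; rewrite mxE.
rewrite -det_mulmx; congr (\det _); apply/matrixP => i j.
by rewrite mul_diag_mx !mxE.
Qed.

(* Expanding the j-th summand along row j and exchanging the two sums turns
   the inner sum into an expansion of the original determinant along column i. *)
Lemma rowdet_mul_sum g (y : 'I_n -> R) :
  rowdet g * \sum_(i < n) y i =
  \sum_(j < n) rowdet (upd g j (\row_i (y i * g j 0 i))).
Proof.
pose A : 'M[R]_n := \matrix_(l < n) g l.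
have -> : \sum_(j < n) rowdet (upd g j (\row_i (y i * g j 0 i))) =
    \sum_(j < n) \sum_(i < n) y i * A j i * cofactor A j i.
  apply: eq_bigr => j _; rewrite /rowdet (expand_det_row _ j).
  apply: eq_bigr => i _; rewrite !mxE /upd eqxx mxE; congr (_ * (_ * \det _)).
  apply/matrixP=> a b; rewrite !mxE.
  by have := neq_lift j a; rewrite -val_eqE /= eq_sym => /negbTE->.
rewrite exchange_big mulr_sumr; apply: eq_bigr => i _.
rewrite mulrC /rowdet (expand_det_col _ i) mulr_sumr.
by apply: eq_bigr => j _; rewrite mulrA.
Qed.

End RowDet.

(** * Chains and the telescoping row expansion *)

Section Chains.
Variables (n N : nat) (lam : nat -> nat).
Local Notation T := {ffun 'I_n -> 'I_N.+1}.

(** Functions into ['I_N.+1] form a finite type over which mu can be summed; [ev] reads them as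
    [nth 0] reads tuples, with value 0 past [n]. *)
Definition ev {n N : nat} (mu : {ffun 'I_n -> 'I_N.+1}) (l : nat) : nat :=
  if insub l is Some o then mu o else 0%N.

Lemma ev_ord (mu : T) (o : 'I_n) : ev mu o = mu o.
Proof. by rewrite /ev valK. Qed.

Lemma evE (mu : T) l (ln : (l < n)%N) : ev mu l = mu (Ordinal ln).
Proof. exact: (ev_ord mu (Ordinal ln)). Qed.

Definition updf {n N : nat} (mu : {ffun 'I_n -> 'I_N.+1}) (i b : nat) :
    {ffun 'I_n -> 'I_N.+1} :=
  [ffun l => if val l == i then inord b else mu l].

Lemma ev_updf (mu : T) i b l : (l < n)%N -> (b <= N)%N ->
  ev (updf mu i b) l = if l == i then b else ev mu l.
Proof.
by move=> ln bN; rewrite !evE ffunE /=; case: eqP => // _; rewrite inordK.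
Qed.

(* The mu for which mu/lam is connected, occupies rows i, ..., i + m and has
   mu_i = b, except that b is not compared with lam_i and lam_(i - 1). *)
Definition chain (m i b : nat) (mu : T) : bool :=
  [forall l : 'I_n, if val l == i then ev mu l == b
    else if (i < l <= i + m)%N then (lam l.-1 < ev mu l <= ev mu l.-1)%N
    else ev mu l == lam l].

Lemma chainP m i b (mu : T) : reflect (forall l, (l < n)%N ->
    if l == i then ev mu l == b
    else if (i < l <= i + m)%N then (lam l.-1 < ev mu l <= ev mu l.-1)%N
    else ev mu l == lam l) (chain m i b mu).
Proof.
apply: (iffP forallP) => [c l ln|c l]; last exact: (c l (ltn_ord l)).
exact: (c (Ordinal ln)).
Qed.

Lemma big_chain0 (R : nmodType) (X : T -> R) i b (mu : T) :
    (forall l, (l < n)%N -> ev mu l = if l == i then b else lam l) ->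
  \sum_(mu | chain 0 i b mu) X mu = X mu.
Proof.
move=> muE; rewrite (big_pred1 mu) // => mu'; apply/chainP/eqP => [c|-> l ln].
  apply/ffunP=> o; apply: val_inj; rewrite /= -!ev_ord muE //.
  have := c o (ltn_ord o); case: eqP => li; first by move/eqP.
  by case: ifP => [|_ /eqP//]; lia.
by rewrite muE //; case: eqP => // li; case: ifP => //; lia.
Qed.

Hypothesis lam_le : forall l, (lam l <= N)%N.

(** Peels off row i: u is the part in row i + 1, and the rest is a chain starting there. That chain
    has the part lam_i in row i, which [updf] replaces by b. *)
Lemma big_chainS (R : nmodType) (X : T -> R) m i b :
    (i.+1 < n)%N -> (b <= N)%N ->
  \sum_(mu | chain m.+1 i b mu) X mu =
  \sum_((lam i).+1 <= u < b.+1) \sum_(mu | chain m i.+1 u mu) X (updf mu i b).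
Proof.
move=> i1n bN; have lin : (i < n)%N by exact: ltnW.
have -> : \sum_((lam i).+1 <= u < b.+1) \sum_(mu | chain m i.+1 u mu) X (updf mu i b)
    = \sum_(u < N.+1 | (lam i < u <= b)%N)
        \sum_(mu | chain m i.+1 u mu) X (updf mu i b).
  rewrite big_geq_mkord (big_ord_widen_cond N.+1 (fun u => lam i < u)%N
    (fun u => \sum_(mu | chain m i.+1 u mu) X (updf mu i b))) //.
rewrite (partition_big (fun mu : T => mu (Ordinal i1n))
    (fun u : 'I_N.+1 => (lam i < u <= b)%N)) /=; last first.
  move=> mu /chainP c; rewrite -evE.
  have := c _ i1n; rewrite (gtn_eqF (ltnSn i)) /= leqnn /= addnS ltnS leq_addr.
  by have := c _ lin; rewrite eqxx => /eqP->.
apply: eq_bigr => u /andP[lu ub].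
rewrite (reindex_onto (fun mu => updf mu i b) (fun mu => updf mu i (lam i))) /=.
  apply: eq_bigl => mu; apply/idP/idP => [/andP[/andP[/chainP c /eqP um] /eqP mE]|/chainP c].
    apply/chainP => l ln; have := c l ln; rewrite !ev_updf //; last by lia.
    have [->|li1] := eqVneq l i.+1.
      by rewrite -um -evE ev_updf // (gtn_eqF (ltnSn i)).
    have [->|li] := eqVneq l i.
      by move=> _; rewrite ltnNge leqnSn -mE ev_updf // ?eqxx /=.
    have -> : (l.-1 == i) = false by lia.
    by rewrite addSnnS; have -> : (i < l)%N = (i.+1 < l)%N by lia.
  apply/andP; split; last first.
    apply/eqP/ffunP => o; apply: val_inj; rewrite /= -!ev_ord !ev_updf //.
    case: eqP => // oi; have := c o (ltn_ord o); rewrite oi.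
    by case: eqP => [|_]; [lia|]; case: ifP => [|_ /eqP<-//]; lia.
  have cu := c _ i1n; rewrite eqxx in cu; move/eqP: cu => cu.
  apply/andP; split.
    apply/chainP => l ln; have := c l ln; rewrite !ev_updf //; last by lia.
    have [->|li] := eqVneq l i; first by rewrite eqxx.
    have [->|li1] := eqVneq l i.+1.
      by rewrite /= eqxx cu lu ub leqnn /= addnS ltnS leq_addr.
    have -> : (l.-1 == i) = false by lia.
    by rewrite addSnnS; have -> : (i < l)%N = (i.+1 < l)%N by lia.
  by rewrite -val_eqE /= -evE ev_updf // (gtn_eqF (ltnSn i)) cu.
move=> mu /andP[/chainP c _]; apply/ffunP => o; apply: val_inj.
rewrite /= -!ev_ord !ev_updf //; case: eqP => // oi.
by have := c o (ltn_ord o); rewrite oi eqxx => /eqP->.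
Qed.

End Chains.

(** With w = v - g_i, subtracting row j from row i turns the rows (v, w) into (g_i, w); adding row i
    to row j then gives (g_i, v). *)
Lemma rowdet_upd_exchange (R : comNzRingType) (n : nat) (g : nat -> 'rV[R]_n)
    (v : 'rV[R]_n) i j : (i < n)%N -> (j < n)%N -> i != j ->
  rowdet (upd (upd g i v) j (v - g i)) = rowdet (upd g j v).
Proof.
move=> lin ljn ij; set w := v - g i.
have updC x y : rowdet (upd (upd g i x) j y) = rowdet (upd (upd g j y) i x).
  apply: eq_rowdet => l _; rewrite /upd.
  by have [->|//] := eqVneq l j; rewrite eq_sym (negbTE ij).
have {1}-> : v = w + g i by rewrite subrK.
rewrite updC rowdet_updD // (@rowdet_alternate _ _ _ i j) //; last first.
  by rewrite /upd !eqxx eq_sym (negbTE ij).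
rewrite add0r -updC (@eq_rowdet _ _ _ (upd g j w)) => [|l _]; last first.
  by rewrite /upd; case: eqP => // _; case: eqP => // ->.
rewrite rowdet_updB // [X in _ - X](@rowdet_alternate _ _ _ i j) ?subr0 //.
by rewrite /upd eqxx (negbTE ij).
Qed.

Section RowExpansion.
Variables (R : comNzRingType) (n N : nat) (b : R) (F : nat -> nat -> 'rV[R]_n).
Variable (lam : nat -> nat).
Hypothesis F_rec : forall l u, (l.+1 < n)%N ->
  F l.+1 u.+1 = b *: (F l u.+1 - F l u).
Hypothesis lam_dec : forall l, (lam l.+1 <= lam l)%N.
Hypothesis lam_le : forall l, (lam l <= N)%N.

(* The inner sums telescope by [F_rec], from the bottom row of the chain up. *)
Lemma sum_chain_rowdet m i t (g : nat -> 'rV[R]_n) :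
    (i + m < n)%N -> (t <= N)%N -> (m == 0)%N || (lam i <= t)%N ->
  \sum_(mu : {ffun 'I_n -> 'I_N.+1} | chain lam m i t mu)
     rowdet (fun l => if (l < i)%N then g l else F l (ev mu l)) =
  b ^+ m * rowdet (upd (fun l => if (l < i)%N then g l else F l (lam l))
                       (i + m) (F i t)).
Proof.
elim: m i t g => [|m IHm] i t g imn tN lit.
  rewrite (@big_chain0 _ _ _ _ _ _ _
    [ffun l : 'I_n => inord (if val l == i then t else lam l)]); last first.
    by move=> l ln; rewrite evE ffunE /= inordK // ltnS; case: eqP => _; rewrite ?lam_le.
  rewrite mul1r addn0; apply: eq_rowdet => l ln; rewrite /upd.
  rewrite evE ffunE /= inordK ?ltnS; last by case: eqP => _; rewrite ?lam_le.
  by case: eqP => // ->; rewrite ltnn.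
have i1n : (i.+1 < n)%N by apply: leq_ltn_trans imn; rewrite addnS ltnS leq_addr.
rewrite big_chainS //=.
pose G l := if (l < i)%N then g l else F l (lam l).
have Gi : G i = F i (lam i) by rewrite /G ltnn.
have -> : \sum_((lam i).+1 <= u < t.+1)
    \sum_(mu : {ffun 'I_n -> 'I_N.+1} | chain lam m i.+1 u mu)
      rowdet (fun l => if (l < i)%N then g l else F l (ev (updf mu i t) l)) =
    \sum_((lam i).+1 <= u < t.+1)
      b ^+ m * rowdet (upd (upd G i (F i t)) (i + m.+1) (F i.+1 u)).
  apply: eq_big_nat => u /andP[lu ut].
  (* Row i is final from here on, so it joins the rows [g] that the induction hypothesis leaves
     alone. *)
  transitivity (\sum_(mu : {ffun 'I_n -> 'I_N.+1} | chain lam m i.+1 u mu)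
      rowdet (fun l => if (l < i.+1)%N then upd g i (F i t) l else F l (ev mu l))).
    apply: eq_bigr => mu _; apply: eq_rowdet => l ln; rewrite ev_updf // /upd.
    by rewrite ltnS (leq_eqVlt l); have [->|_] := eqVneq l i; rewrite ?ltnn.
  rewrite IHm ?addSnnS //; last 2 first.
  - exact: leq_trans tN.
  - by rewrite (leq_trans (lam_dec i)) ?orbT // ltnW.
  congr (_ * _); apply: eq_rowdet => l _; rewrite /upd /G ltnS (leq_eqVlt l).
  by case: eqP => // _; have [->|_] := eqVneq l i.
have ni : i != (i + m.+1)%N by lia.
(* The sum over u telescopes to b (F_i(t) - F_i(lam_i)) in row i + m + 1, while row i holds F_i(t).
   The exchange lemma moves F_i(t) down and restores F_i(lam_i) in row i. *)
rewrite -mulr_sumr -rowdet_upd_sum // big_add1 /=.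
rewrite (eq_bigr (fun u => b *: (F i u.+1 - F i u))) => [|u _]; last exact: F_rec.
rewrite -scaler_sumr telescope_sumr // -Gi rowdet_updZ // mulrA -exprSr.
by rewrite rowdet_upd_exchange // ltnW.
Qed.

(* The expansion of [F j B] as a (j - i)-fold difference, cut after p terms. *)
Definition binom_row (j B i p : nat) : 'rV[R]_n :=
  \sum_(0 <= d < p) ((-1) ^+ d *+ 'C(j - i, d) * b ^+ (j - i)) *: F i (B - d)%N.

(** Substituting [F_rec] into the sum for i + 1 and collecting by Pascal's rule gives the sum for i,
    except that the cut leaves over one multiple of F_i(B - p). *)
Lemma binom_rowS j B i p : (i < j < n)%N -> (p <= B)%N ->
  exists c, binom_row j B i p = binom_row j B i.+1 p + c *: F i (B - p)%N.
Proof.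
move=> /andP[ij jn] pB; have i1n : (i.+1 < n)%N by exact: leq_ltn_trans jn.
set m := (j - i.+1)%N; have mE : (j - i)%N = m.+1 by rewrite /m; lia.
have F_recB d : (d < B)%N ->
    F i.+1 (B - d)%N = b *: (F i (B - d)%N - F i (B - d.+1)%N).
  move=> dB; have -> : (B - d = (B - d.+1).+1)%N by lia.
  exact: F_rec.
case: p pB => [|p] pB.
  by exists 0; rewrite /binom_row !big_geq // scale0r addr0.
exists ((-1) ^+ p *+ 'C(m, p) * b ^+ m.+1).
elim: p pB => [|p IHp] pB.
  rewrite /binom_row !big_nat1 mE !bin0 F_recB // -/m.
  by rewrite scalerA -mulrA -exprSr scalerBr subrK.
rewrite {1}/binom_row big_nat_recr //= -/(binom_row _ _ _ _) (IHp (ltnW pB)).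
rewrite [in RHS]/binom_row big_nat_recr //= -/(binom_row _ _ _ _) -!addrA.
rewrite mE -/m F_recB // scalerA -mulrA -exprSr scalerBr subrK -scalerDl.
congr (_ + _ *: _); rewrite binS mulrnDr (exprS (-1)) mulN1r.
by rewrite mulrDl addrCA !mulNrn !mulNr subrr addr0.
Qed.

(** The bounds on d mean lam_i < B - d <= lam_{i-1}, without the upper bound when i = 0: B - d is
    the top part of a shape with top row i. *)
Lemma rowdet_pieri j B (g := fun l => F l (lam l)) :
    (j < n)%N -> (lam j < B <= N)%N ->
  rowdet (upd g j (F j B)) =
  \sum_(i < j.+1) \sum_((if val i is i'.+1 then B - lam i' else 0) <= d < B - lam i)
     (-1) ^+ d *+ 'C(j - i, d) *
     \sum_(mu : {ffun 'I_n -> 'I_N.+1} | chain lam (j - i) i (B - d) mu)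
       rowdet (fun l => F l (ev mu l)).
Proof.
move=> jn /andP[lB BN].
transitivity (\sum_(i < j.+1)
  \sum_((if val i is i'.+1 then B - lam i' else 0) <= d < B - lam i)
     rowdet (upd g j (((-1) ^+ d *+ 'C(j - i, d) * b ^+ (j - i)) *: F i (B - d)%N)));
  last first.
  apply: eq_bigr => i _; apply: eq_big_nat => d /andP[_ dB].
  have ij : (i <= j)%N by rewrite -ltnS.
  rewrite rowdet_updZ // -mulrA; congr (_ * _).
  have := @sum_chain_rowdet (j - i) i (B - d) g; rewrite subnKC // => E.
  rewrite (@eq_rowdet _ _ (upd g j _) (upd (fun l => if (l < i)%N then g l
    else F l (lam l)) j (F i (B - d)%N))) => [|l _]; last first.
    by rewrite /upd /g; case: ifP => // _; case: ifP.
  rewrite -E //; last 2 first.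
  - by rewrite (leq_trans _ BN) // leq_subr.
  - by apply/orP; right; lia.
  apply: eq_bigr => mu /chainP c; apply: eq_rowdet => l ln.
  case: ifP => // li; have := c l ln; rewrite (ltn_eqF li).
  by rewrite [(i < l)%N]ltnNge (ltnW li) /= /g => /eqP->.
(* The terms up to row i add up to the expansion through F_i, cut at parts above lam_i. At i = j
   only d = 0 survives, which is F_j(B). *)
have H i : (i <= j)%N -> \sum_(i' < i.+1)
  \sum_((if val i' is i''.+1 then B - lam i'' else 0) <= d < B - lam i')
     rowdet (upd g j (((-1) ^+ d *+ 'C(j - i', d) * b ^+ (j - i')) *: F i' (B - d)%N))
  = rowdet (upd g j (binom_row j B i (B - lam i))).
  elim: i => [|i IHi] ij.
    by rewrite big_ord1 -rowdet_upd_sum.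
  rewrite big_ord_recr IHi ?(ltnW ij) //= -rowdet_upd_sum //.
  have ij' : (i < j < n)%N by rewrite ij.
  (* Passing from i to i + 1 changes row j by a multiple of F_i(lam_i), which is row i already; if
     lam_i > B, both sums are empty. *)
  have -> : rowdet (upd g j (binom_row j B i (B - lam i))) =
            rowdet (upd g j (binom_row j B i.+1 (B - lam i))).
    have [lB'|lB'] := leqP (lam i) B; last first.
      by rewrite /binom_row !big_geq //; lia.
    have [c ->] := binom_rowS ij' (leq_subr (lam i) B).
    rewrite rowdet_updD // rowdet_updZ // subKn //.
    rewrite [X in c * X](@rowdet_alternate _ _ _ i j) ?mulr0 ?addr0 //.
    - exact: ltn_trans jn.
    - by rewrite ltn_eqF.
    by rewrite /upd eqxx ltn_eqF.
  rewrite -rowdet_updD // /binom_row [in RHS](@big_cat_nat _ _ _ (B - lam i)%N) //=.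
  by rewrite leq_sub2l.
rewrite H // /binom_row subnn big_ltn ?subn_gt0 // bin0 expr0 mul1r scale1r subn0.
rewrite big1_seq ?addr0 // => d; rewrite mem_index_iota => /andP[_ /andP[d0 _]].
by rewrite bin_small // mul0r scale0r.
Qed.
End RowExpansion.

(** * Connected skew shapes *)

(** Encodes that mu/lam is connected with top row i and bottom row j: lam_{l-1} < mu_l makes rows l
    - 1 and l share a column. The bound mu_i <= lam_{i-1} keeps mu decreasing, as row i - 1 is
    unchanged. *)
Definition strip (n : nat) (lam mu : nat -> nat) (i j : nat) : bool :=
  [&& (i <= j < n)%N, (lam i < mu i)%N, (i == 0)%N || (mu i <= lam i.-1)%N &
   [forall l : 'I_n, if (i < l <= j)%N then (lam l.-1 < mu l <= mu l.-1)%N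
                     else (val l != i) ==> (mu l == lam l)]].

Lemma stripP n lam mu i j :
  reflect [/\ (i <= j < n)%N, (lam i < mu i)%N,
              (0 < i)%N -> (mu i <= lam i.-1)%N,
              forall l, (i < l <= j)%N -> (lam l.-1 < mu l <= mu l.-1)%N &
              forall l, (l < n)%N -> (l < i)%N || (j < l)%N -> mu l = lam l]
          (strip n lam mu i j).
Proof.
apply: (iffP and4P) => [[ijn lmi mui /forallP c]|[ijn lmi mui c1 c2]].
  split=> // [i0|l ilj|l ln lij].
  - by move: mui; rewrite (gtn_eqF i0).
  - have ln : (l < n)%N by lia.
    by have := c (Ordinal ln); rewrite /= ilj.
  have := c (Ordinal ln); rewrite /= ifF; last by lia.
  by move=> /implyP h; apply/eqP/h; lia.
split=> //; first by case: (posnP i) => [->//|/mui->]; rewrite orbT.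
apply/forallP => l; case: ifP => [/c1//|lij]; apply/implyP => /= li.
by apply/eqP/c2 => //; lia.
Qed.


Lemma nth_partition n (lam : n.-tuple nat) l :
  is_partition lam -> (nth 0 lam l.+1 <= nth 0 lam l)%N.
Proof.
move=> plam; have [ln|nl] := ltnP l.+1 n; last by rewrite nth_default ?size_tuple.
by apply: (sorted_ltn_nth (rev_trans leq_trans) 0%N plam);
  rewrite ?inE ?size_tuple // ltnW.
Qed.

Lemma partition_nth n (lam : n.-tuple nat) :
  (forall l, (l.+1 < n)%N -> (nth 0 lam l.+1 <= nth 0 lam l)%N) -> is_partition lam.
Proof.
by move=> dec; apply/(sortedP 0%N) => l; rewrite size_tuple => /dec.
Qed.

Lemma part_leP n (lam mu : n.-tuple nat) :
  reflect (forall l, (nth 0 lam l <= nth 0 mu l)%N) (part_le lam mu).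
Proof.
apply: (iffP forallP) => le l; last by rewrite !(tnth_nth 0%N).
have [ln|nl] := ltnP l n; last by rewrite nth_default ?size_tuple.
by have := le (Ordinal ln); rewrite !(tnth_nth 0%N).
Qed.

Section Strips.
Variables (n : nat) (lam : n.-tuple nat).
Hypothesis lam_part : is_partition lam.
Local Notation L := (nth 0%N lam).

Let Ldec l : (L l.+1 <= L l)%N. Proof. exact: nth_partition. Qed.

Let Lmono l l' : (l <= l')%N -> (L l' <= L l)%N.
Proof.
elim: l' => [|l' IH]; first by rewrite leqn0 => /eqP->.
rewrite leq_eqVlt => /predU1P[->//|/IH]; exact: leq_trans (Ldec l').
Qed.

Lemma strip_lt (mu : n.-tuple nat) i j l :
  strip n L (nth 0%N mu) i j -> (i <= l <= j)%N -> (L l < nth 0 mu l)%N.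
Proof.
move=> /stripP[_ lmi _ c _] /andP[]; rewrite leq_eqVlt => /predU1P[<-//|il lj].
have /andP[+ _] := c l (introT andP (conj il lj)); apply: leq_ltn_trans.
by apply: Lmono; exact: leq_pred.
Qed.

(** Rows i and j are the first and the last in which mu exceeds lam. *)
Lemma strip_uniq (mu : n.-tuple nat) i j i' j' :
  strip n L (nth 0%N mu) i j -> strip n L (nth 0%N mu) i' j' -> i = i' /\ j = j'.
Proof.
have key a b a' b' : strip n L (nth 0%N mu) a b -> strip n L (nth 0%N mu) a' b' ->
    (a <= a')%N && (b' <= b)%N.
  move=> s s'; have [/andP[ab' bn'] _ _ _ _] := stripP _ _ _ _ _ s'.
  have [/andP[ab bn] _ _ _ c] := stripP _ _ _ _ _ s.
  apply/andP; split; rewrite leqNgt; apply/negP => lt.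
    by have := strip_lt s' (_ : a' <= a' <= b')%N; rewrite c ?ltnn ?lt ?leqnn //; lia.
  by have := strip_lt s' (_ : a' <= b' <= b')%N; rewrite c ?ltnn ?lt ?leqnn ?orbT //; lia.
by move=> s s'; have := key _ _ _ _ s s'; have := key _ _ _ _ s' s; lia.
Qed.

Lemma strip_part_le (mu : n.-tuple nat) i j :
  strip n L (nth 0%N mu) i j -> part_le lam mu.
Proof.
move=> s; have [_ _ _ _ c] := stripP _ _ _ _ _ s; apply/part_leP => l.
have [ilj|] := boolP (i <= l <= j)%N; first exact/ltnW/(strip_lt s).
have [ln|nl] := ltnP l n; last by rewrite nth_default ?size_tuple.
by move=> ilj; rewrite c //; lia.
Qed.

Lemma strip_partition (mu : n.-tuple nat) i j :
  strip n L (nth 0%N mu) i j -> is_partition mu.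
Proof.
move=> s; have [/andP[ij jn] _ c0 c1 c2] := stripP _ _ _ _ _ s.
have /part_leP le := strip_part_le s.
apply: partition_nth => l ln.
have [/c1/andP[]//|out] := boolP (i < l.+1 <= j)%N.
have [li|li] := eqVneq l.+1 i.
  by rewrite [nth 0 mu l]c2 ?li; [have := c0; rewrite -li; exact|lia|lia].
rewrite [nth 0 mu l.+1]c2 //; last by lia.
exact: leq_trans (Ldec l) (le l).
Qed.

Lemma mem_skew_shape_strip (mu : n.-tuple nat) i j a c :
  strip n L (nth 0%N mu) i j ->
  ((a, c) \in skew_shape mu lam) = [&& (i <= a <= j)%N, (L a <= c)%N & (c < nth 0 mu a)%N].
Proof.
move=> s; have [/andP[ij jn] _ c0 c1 c2] := stripP _ _ _ _ _ s.
rewrite mem_skew_shape; have [ilj|out] := boolP (i <= a <= j)%N.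
  by have -> : (a < n)%N by lia.
have [an|//] := ltnP a n; rewrite c2 //=; last by lia.
by rewrite [RHS]/=; lia.
Qed.

Lemma strip_nrows (mu : n.-tuple nat) i j :
  strip n L (nth 0%N mu) i j -> nrows (skew_shape mu lam) = (j - i).+1.
Proof.
move=> s; have [/andP[ij jn] _ _ _ _] := stripP _ _ _ _ _ s.
rewrite -(size_iota i (j - i).+1); apply/perm_size/uniq_perm;
  rewrite ?undup_uniq ?iota_uniq // => a.
rewrite mem_undup mem_iota; apply/mapP/idP => [[[a' c] + ->]|ia].
  by rewrite (mem_skew_shape_strip _ _ s) /=; lia.
have iaj : (i <= a <= j)%N by lia.
by exists (a, L a) => //; rewrite (mem_skew_shape_strip _ _ s) iaj leqnn (strip_lt s).
Qed.

(** Neighbouring rows share a column, so the occupied columns form the interval from lam_j to mu_i -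
    1. *)
Lemma strip_ncols (mu : n.-tuple nat) i j :
  strip n L (nth 0%N mu) i j -> ncols (skew_shape mu lam) = (nth 0 mu i - L j)%N.
Proof.
move=> s; have [/andP[ij jn] lmi _ c1 _] := stripP _ _ _ _ _ s.
have Lji : (L j < nth 0 mu i)%N := leq_ltn_trans (Lmono ij) lmi.
rewrite -(size_iota (L j) (nth 0 mu i - L j)); apply/perm_size/uniq_perm;
  rewrite ?undup_uniq ?iota_uniq // => c.
rewrite mem_undup mem_iota subnKC ?(ltnW Lji) //.
apply/mapP/idP => [[[a c'] + ->]|/andP[jc ci]] /=.
  rewrite (mem_skew_shape_strip _ _ s) => /and3P[/andP[ia aj] ac ca].
  rewrite (leq_trans (Lmono aj)) //=; apply: leq_trans ca _.
  elim: a ia aj {ac} => [|a IH] ia aj; first by move: ia; rewrite leqn0 => /eqP->.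
  move: ia; rewrite leq_eqVlt => /predU1P[->//|ia].
  have /andP[_ /leq_trans->//] := c1 a.+1 (introT andP (conj ia aj)).
  by apply: IH; lia.
(* Column c is met by the first row a >= i with lam_a <= c: if a > i, minimality gives c <=
   lam_{a-1} < mu_a. *)
have [a [ia aj ac ca]] : exists a, [/\ (i <= a)%N, (a <= j)%N, (L a <= c)%N & (c < nth 0 mu a)%N].
  have ex : exists a, (i <= a)%N && (L a <= c)%N by exists j; rewrite ij.
  exists (ex_minn ex); case: ex_minnP => a /andP[ia ac] amin.
  have aj : (a <= j)%N by apply: amin; rewrite ij.
  split=> //; move: ia; rewrite leq_eqVlt => /predU1P[<-//|ia].
  have /andP[+ _] := c1 a (introT andP (conj ia aj)); apply: leq_trans.
  rewrite ltnS leqNgt; apply/negP => cl.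
  by have := amin a.-1; rewrite (ltnW cl); lia.
by exists (a, c) => //; rewrite (mem_skew_shape_strip _ _ s) ia aj ac.
Qed.

Lemma size_young (mu : n.-tuple nat) : size (young mu) = sumn mu.
Proof.
rewrite size_allpairs_dep; congr sumn; apply: (@eq_from_nth _ 0%N).
  by rewrite size_map size_iota size_tuple.
move=> l; rewrite size_map size_iota => ln.
by rewrite (nth_map 0%N) ?size_iota // nth_iota.
Qed.

Lemma young_uniq (mu : n.-tuple nat) : uniq (young mu).
Proof.
apply: allpairs_uniq_dep => [|l _|]; rewrite ?iota_uniq //.
by move=> [a c] [a' c'] _ _ /= [-> ->].
Qed.

Lemma size_skew_shape (mu : n.-tuple nat) : part_le lam mu ->
  (size (skew_shape mu lam) + sumn lam)%N = sumn mu.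
Proof.
move=> /part_leP le; rewrite -!size_young size_filter -(count_predC (mem (young lam)) (young mu)).
rewrite [RHS]addnC; congr (_ + _)%N; rewrite -size_filter.
apply/perm_size/uniq_perm; rewrite ?filter_uniq ?young_uniq // => -[a c].
rewrite mem_filter inE !mem_young; case: (ltnP a n) => //= _.
by apply/idP/andP => [ca|[]//]; rewrite ca (leq_trans ca).
Qed.


Lemma reach_sym (D : seq (nat * nat)) a b p :
    a \in D -> path adjacent a p -> {subset p <= D} -> last a p = b ->
  exists p', [/\ path adjacent b p', {subset p' <= D} & last b p' = a].
Proof.
move=> aD pa pD pb; exists (rev (belast a p)); split.
- rewrite -pb rev_path (@eq_path _ _ adjacent) // => -[x1 x2] [y1 y2].
  by rewrite /adjacent /= ![y1 == _]eq_sym ![y2 == _]eq_sym; congr (_ && _ || _ && _);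
    rewrite orbC ![_.+1 == _]eq_sym.
- by move=> x; rewrite mem_rev => /mem_belast; rewrite inE => /predU1P[->|/pD].
by case: p {pa pD} pb => [//|y p] _; rewrite /= rev_cons last_rcons.
Qed.

(** Every box reaches (j, lam_j): go left to the start of its row, step down, and repeat. The step
    down from (a, lam_a) stays in the shape because lam_a < mu_{a+1}. *)
Lemma strip_connected (mu : n.-tuple nat) i j :
  strip n L (nth 0%N mu) i j -> connected_shape (skew_shape mu lam).
Proof.
move=> s; have [/andP[ij jn] _ _ c1 _] := stripP _ _ _ _ _ s.
set D := skew_shape mu lam.
pose reach a b := exists p, [/\ path adjacent a p, {subset p <= D} & last a p = b].
have reach_trans a b c : reach a b -> reach b c -> reach a c.
  move=> [p [pa pD pb]] [q [qa qD qc]]; exists (p ++ q); split.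
  - by rewrite cat_path pa pb.
  - by move=> x; rewrite mem_cat => /orP[/pD|/qD].
  by rewrite last_cat pb.
have reach_adj a b : adjacent a b -> b \in D -> reach a b.
  move=> ab bD; exists [:: b]; split=> //=; first by rewrite ab.
  by move=> x; rewrite inE => /eqP->.
have reachC a b : a \in D -> reach a b -> reach b a.
  by move=> aD [p [pa pD pb]]; apply: (@reach_sym D a b p).
have inD := mem_skew_shape_strip _ _ s.
have row a d : (i <= a <= j)%N -> (L a + d < nth 0 mu a)%N -> reach (a, L a + d)%N (a, L a).
  move=> aij; elim: d => [|d IHd] dm; first by exists [::]; rewrite addn0.
  apply: (reach_trans _ (a, L a + d)%N); last by apply: IHd; lia.
  apply: reach_adj; first by rewrite /adjacent /= eqxx addnS eqxx.
  by rewrite inD aij leq_addr; lia.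
have diag a d : (a + d = j)%N -> (i <= a)%N -> reach (a, L a) (j, L j).
  elim: d a => [|d IHd] a adj ia; first by exists [::]; split=> //=; rewrite -adj addn0.
  apply: (reach_trans _ (a.+1, L a)).
    apply: reach_adj; first by rewrite /adjacent /= !eqxx !orbT.
    by rewrite inD Ldec; have := c1 a.+1; rewrite /=; lia.
  apply: (reach_trans _ (a.+1, L a.+1)); last by apply: IHd; lia.
  rewrite -{1}(subnKC (Ldec a)); apply: row; first by lia.
  by rewrite subnKC ?Ldec //; have := c1 a.+1; rewrite /=; lia.
have root a : a \in D -> reach a (j, L j).
  case: a => a c; rewrite inD => /and3P[aij ac ca].
  apply: (reach_trans _ (a, L a)); last by apply: (diag _ (j - a)%N); lia.
  by rewrite -(subnKC ac); apply: row; rewrite ?subnKC.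
move=> a b aD bD; apply: (reach_trans _ (j, L j)); first exact: root.
exact/reachC/root.
Qed.

(** Take the first and last nonempty rows i and j. If mu_{l+1} <= lam_l with i <= l < j, no box of
    row l is adjacent to one of row l + 1, so a path from row i never leaves the rows up to l. *)
Lemma connected_strip (mu : n.-tuple nat) :
    is_partition mu -> part_le lam mu -> connected_shape (skew_shape mu lam) ->
  (0 < size (skew_shape mu lam))%N ->
  exists i j, strip n L (nth 0%N mu) i j.
Proof.
move=> pmu /part_leP le conn; rewrite -has_predT => /hasP[[a0 c0]].
rewrite mem_skew_shape => /and3P[an0 ac0 ca0] _.
have ex : exists l, (l < n)%N && (L l < nth 0 mu l)%N.
  by exists a0; rewrite an0 (leq_ltn_trans ac0).
exists (ex_minn ex); case: ex_minnP => i /andP[lin lmi] imin.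
have ub l : (l < n)%N && (L l < nth 0 mu l)%N -> (l <= n)%N by case/andP => /ltnW.
exists (ex_maxn ex ub); case: ex_maxnP => j /andP[ljn lmj] jmax.
have ij : (i <= j)%N by apply: imin; rewrite ljn.
have outE l : (l < n)%N -> (l < i)%N || (j < l)%N -> nth 0 mu l = L l.
  move=> ln lij; apply/eqP; rewrite eqn_leq le andbT leqNgt; apply/negP => lt.
  by have := imin l; have := jmax l; rewrite ln lt; lia.
apply/stripP; split=> //; first by rewrite ij.
- case: i lin outE {lmi imin ij} => // i lin outE _.
  by rewrite -outE ?ltnSn ?(ltnW lin) //; apply: nth_partition.
case=> // l /andP[il lj] /=; rewrite nth_partition // andbT ltnNge; apply/negP => ml.
have inv p a : path adjacent a p -> {subset p <= skew_shape mu lam} ->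
    a \in skew_shape mu lam -> (a.1 <= l)%N -> ((last a p).1 <= l)%N.
  elim: p a => [//|b p IHp] a /= /andP[ab bp] pD aD al.
  have bD : b \in skew_shape mu lam by apply: pD; rewrite mem_head.
  apply: IHp => // [x xp|]; first by apply: pD; rewrite inE xp orbT.
  rewrite leqNgt; apply/negP => lb; move: aD bD ab al lb.
  case: a b {bp pD} => [a1 a2] [b1 b2]; rewrite !mem_skew_shape /adjacent /=.
  move=> /and3P[_ aa _] /and3P[_ _ bb] ab al lb.
  have [a1l b1l] : a1 = l /\ b1 = l.+1 by move: ab; lia.
  by subst; lia.
have [||p [pa pD pl]] := conn (i, L i) (j, L j).
- by rewrite mem_skew_shape lin leqnn.
- by rewrite mem_skew_shape ljn leqnn.
have := inv p (i, L i) pa pD; rewrite pl mem_skew_shape lin leqnn lmi /=.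
by move=> /(_ isT); lia.
Qed.

Lemma leq_size_skew_shape (mu nu : n.-tuple nat) : part_le nu mu ->
  (size (skew_shape nu lam) <= size (skew_shape mu lam))%N.
Proof.
move=> /part_leP le; apply: uniq_leq_size => [|[a c]].
  exact/filter_uniq/young_uniq.
rewrite !mem_skew_shape => /and3P[-> -> /= ca]; exact: leq_trans (le a).
Qed.

(** The ribbon nu keeps the part mu_i and has the part lam_{l-1} + 1 in each row l with i < l <= j,
    so that rows l - 1 and l share exactly one column. Its size is r + c - 1. *)
Lemma strip_max_ribbon (mu : n.-tuple nat) i j :
    strip n L (nth 0%N mu) i j ->
  exists nu, [/\ is_max_ribbon mu lam nu,
    (size (skew_shape nu lam) = nth 0 mu i - L j + (j - i))%N &
    (size (skew_shape nu lam) <= size (skew_shape mu lam))%N].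
Proof.
move=> s; have [/andP[ij jn] lmi c0 c1 c2] := stripP _ _ _ _ _ s.
have /part_leP le := strip_part_le s.
have pmu := strip_partition s.
(* [f t] is this ribbon stopped after row t; varying t allows an induction for the size. *)
pose f t l := if (i < l <= t)%N then (L l.-1).+1
              else if l == i then nth 0%N mu i else L l.
pose nu := [tuple f j (val l) | l < n].
have nuE l : (l < n)%N -> nth 0%N nu l = f j l.
  by move=> ln; rewrite -[l]/(val (Ordinal ln)) -tnth_nth tnth_mktuple.
have snu : strip n L (nth 0%N nu) i j.
  have lin : (i < n)%N by exact: leq_ltn_trans jn.
  apply/stripP; rewrite ij nuE // /f ltnn eqxx; split=> // [l ilj|l ln lij].
    have ln : (l < n)%N by lia.
    rewrite !nuE ?(leq_ltn_trans (leq_pred l)) // /f ilj ltnS leqnn /=.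
    have [->|li] := eqVneq l.-1 i.
      rewrite ltnn /=; have := c1 i.+1; have := nth_partition i pmu; rewrite /=; lia.
    have -> : (i < l.-1 <= j)%N by lia.
    by rewrite ltnS; have := Ldec l.-2; have -> : (l.-2.+1 = l.-1)%N by lia.
  rewrite nuE // /f ifF; last by lia.
  by case: eqP => // li; move: lij; rewrite li ltnn ltnNge ij.
have lenu : part_le nu mu.
  apply/part_leP => l; have [ln|nl] := ltnP l n; last by rewrite nth_default ?size_tuple.
  rewrite nuE // /f; case: ifP => [/c1/andP[]//|_]; by case: eqP => [->|].
exists nu; split; last exact: leq_size_skew_shape.
  split.
    split=> //; [exact: strip_partition snu|exact: strip_part_le snu|split].
      exact: strip_connected snu.
    move=> [a [c []]]; rewrite !(mem_skew_shape_strip _ _ snu).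
    move=> /and3P[iaj ac _] _ _ /and3P[aij _]; rewrite nuE ?(leq_ltn_trans _ jn) //; last by lia.
    rewrite /f; case: ifP => [_ /=|]; first by lia.
    by lia.
  move=> nu' [pnu' /part_leP lnu' /part_leP num [_ nosq]].
  apply: leq_size_skew_shape; apply/part_leP => l.
  have [ln|nl] := ltnP l n; last by rewrite nth_default ?size_tuple.
  rewrite nuE // /f; case: ifP => [/andP[il lj]|ilj]; last first.
    by case: eqP => [->//|li]; rewrite -[leqRHS]c2 //; lia.
  case: l ln il lj => // l ln il lj; rewrite /= leqNgt; apply/negP => lt.
  (* If nu'_{l+1} > lam_l + 1, rows l and l + 1 both contain the columns lam_l and lam_l + 1. *)
  apply: nosq; exists l, (L l); rewrite !mem_skew_shape ln (ltnW ln) /=.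
  have := nth_partition l pnu'; have := Ldec l; split; lia.
apply/eqP; rewrite -(eqn_add2r (sumn lam)) size_skew_shape ?(strip_part_le snu) //.
have swap (g h : nat -> nat) t : (t < n)%N -> (forall l, l != t -> g l = h l) ->
    (\sum_(l < n) g l + h t = \sum_(l < n) h l + g t)%N.
  move=> tn gh; rewrite (bigD1 (Ordinal tn)) //= [in RHS](bigD1 (Ordinal tn)) //=.
  rewrite (eq_bigr (fun l : 'I_n => h l)) => [|l lt]; last exact: gh.
  by rewrite addnAC [RHS]addnAC [(g t + _)%N]addnC.
(* Each further row l adds lam_{l-1} + 1 - lam_l boxes, so the size telescopes. *)
have S d : (i + d < n)%N ->
    (\sum_(l < n) f (i + d) l + L (i + d) = \sum_(l < n) L l + nth 0 mu i + d)%N.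
  elim: d => [|d IHd] idn.
    rewrite addn0 in idn *; rewrite addn0 (swap _ L) // /f ?ltnn ?eqxx // => l /negbTE->.
    by rewrite ifF //; lia.
  have := swap (f (i + d.+1)%N) (f (i + d)%N) (i + d.+1)%N idn.
  have -> : f (i + d.+1)%N (i + d.+1)%N = (L (i + d)).+1.
    by rewrite /f leqnn ifT addnS //= ltnS leq_addr.
  have -> : f (i + d)%N (i + d.+1)%N = L (i + d.+1).
    by rewrite /f !ifF //; lia.
  move=> swp; have {}/swp : forall l, l != (i + d.+1)%N -> f (i + d.+1)%N l = f (i + d)%N l.
    by move=> l li; rewrite /f; congr (if _ then _ else _); lia.
  have := IHd (leq_ltn_trans (leq_add (leqnn i) (leqnSn d)) idn); lia.
have := S (j - i)%N; rewrite subnKC // => /(_ jn).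
have -> : (\sum_(l < n) f j l = sumn nu)%N.
  by rewrite sumnE big_tuple; apply: eq_bigr => l _; rewrite tnth_mktuple.
have -> : (\sum_(l < n) L l = sumn lam)%N.
  by rewrite sumnE big_tuple; apply: eq_bigr => l _; rewrite (tnth_nth 0%N).
have := Lmono ij; lia.
Qed.
End Strips.

(** * The Pieri sum *)

Section Rows.
Variable n : nat.
Local Notation P := {mpoly {poly int}[n]}.

(* The entries of the determinant [groth_num], scaled by a power of [- beta] so
   that the columns satisfy a pure difference equation. *)
Definition groth_row (l a : nat) : 'rV[P]_n :=
  \row_i ((- beta%:MP) ^+ a * ('X_i ^+ (a + (n - l.+1)) * (1 + beta%:MP * 'X_i) ^+ l)).

Lemma groth_row_rec l u : (l.+1 < n)%N ->
  groth_row l.+1 u.+1 = beta%:MP *: (groth_row l u.+1 - groth_row l u).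
Proof.
move=> ln; apply/rowP => i; rewrite !mxE.
have -> : (u + (n - l.+1) = u.+1 + (n - l.+2))%N by lia.
have -> : (u.+1 + (n - l.+1) = (u.+1 + (n - l.+2)).+1)%N by lia.
rewrite !exprS; set w := (1 + _) ^+ l; set x := 'X_i ^+ _; set y := (- _) ^+ u.
by ring.
Qed.

Lemma rowdet_groth (mu : n.-tuple nat) :
  rowdet (fun l => groth_row l (nth 0%N mu l)) =
  (- beta%:MP) ^+ sumn mu * groth_num mu.
Proof.
rewrite /groth_num -det_tr sumnE big_tuple -prodrXr.
rewrite (eq_bigr (fun l : 'I_n => (- beta%:MP) ^+ nth 0%N mu l)) => [|l _]; last first.
  by rewrite (tnth_nth 0%N).
pose g l : 'rV[P]_n := \row_i ('X_i ^+ (nth 0%N mu l + (n - l.+1)) * (1 + beta%:MP * 'X_i) ^+ l).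
rewrite -[X in _ * X](_ : rowdet g = _); last first.
  by congr (\det _); apply/matrixP => i j; rewrite !mxE (tnth_nth 0%N).
rewrite -(rowdet_scale_rows (fun l => (- beta%:MP) ^+ nth 0%N mu l)); apply: eq_rowdet => l _.
by apply/rowP => i; rewrite !mxE.
Qed.

Lemma rowdet_groth_power_sum (lam : n.-tuple nat) k :
  (- beta%:MP) ^+ (sumn lam + k) * (groth_num lam * power_sum n k) =
  \sum_(j < n) rowdet (upd (fun l => groth_row l (nth 0%N lam l)) j
                           (groth_row j (nth 0%N lam j + k))).
Proof.
(* [groth_row] carries the power of - beta given by the part, so raising the part by k also brings
   in (- beta)^k. *)
pose y i : P := (- beta%:MP) ^+ k * 'X_i ^+ k.
transitivity (rowdet (fun l => groth_row l (nth 0%N lam l)) * \sum_i y i).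
  by rewrite rowdet_groth -mulr_sumr -/(power_sum n k) exprD; ring.
rewrite rowdet_mul_sum; apply: eq_bigr => j _; apply: eq_rowdet => l _.
rewrite /upd; case: eqP => // _; apply/rowP => i; rewrite !mxE /y.
by rewrite addnAC !exprD; ring.
Qed.
End Rows.

(** * From chains to strips *)

Section StripSums.
Variables (n N : nat) (lam : nat -> nat).
Local Notation T := {ffun 'I_n -> 'I_N.+1}.

Lemma strip_chain (mu : T) i j : (i <= j < n)%N ->
  strip n lam (ev mu) i j =
  [&& (lam i < ev mu i)%N, (i == 0)%N || (ev mu i <= lam i.-1)%N &
      chain lam (j - i) i (ev mu i) mu].
Proof.
move=> ijn; rewrite /strip ijn /=; congr [&& _, _ & _].
apply: eq_forallb => l /=; have /andP[ij _] := ijn; rewrite subnKC //.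
by have [->|li] := eqVneq (val l) i; rewrite ?ltnn ?eqxx //=; case: ifP.
Qed.

(** Substitute d = B - mu_i. The bounds on d become the conditions lam_i < mu_i <= lam_{i-1} that
    [chain] omits, and d >= 0 becomes mu_i <= B. *)
Lemma sum_strip (R : pzRingType) (X : T -> R) i j B : (i <= j < n)%N ->
  \sum_((if i is i'.+1 then B - lam i' else 0) <= d < B - lam i)
     (-1) ^+ d *+ 'C(j - i, d) * (\sum_(mu | chain lam (j - i) i (B - d) mu) X mu) =
  \sum_(mu | strip n lam (ev mu) i j && (ev mu i <= B)%N)
     (-1) ^+ (B - ev mu i) *+ 'C(j - i, B - ev mu i) * X mu.
Proof.
move=> ijn; pose lo := if i is i'.+1 then (B - lam i')%N else 0%N.
rewrite -/lo big_geq_mkord (big_ord_widen_cond B.+1 (fun d => lo <= d)%N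
  (fun d => (-1) ^+ d *+ 'C(j - i, d) *
            \sum_(mu | chain lam (j - i) i (B - d) mu) X mu)); last first.
  by rewrite (leq_trans (leq_subr _ _)).
rewrite [RHS](partition_big (fun mu => inord (B - ev mu i))
  (fun d : 'I_B.+1 => (lo <= d < B - lam i)%N)) /=; last first.
  move=> mu /andP[]; rewrite strip_chain // => /and3P[lt lei _] leB.
  rewrite inordK ?ltnS ?leq_subr // /lo.
  by case: (i) lt lei leB => [|i'] /=; lia.
apply: eq_bigr => d /andP[lod dhi]; rewrite mulr_sumr.
have inordE (mu : T) : (inord (B - ev mu i) == d) = (B - ev mu i == d)%N.
  by rewrite -val_eqE /= inordK // ltnS leq_subr.
have lin : (i < n)%N by lia.
apply: eq_big => [mu|mu /chainP/(_ i lin)]; last first.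
  by rewrite eqxx => /eqP->; rewrite subKn //; lia.
rewrite inordE strip_chain //; apply/idP/idP => [c|/andP[/andP[/and3P[_ _ c] leB] /eqP dE]].
  have /chainP/(_ i lin) := c; rewrite eqxx => /eqP evE'.
  rewrite evE' c andbT subKn ?eqxx; last by lia.
  rewrite leq_subr !andbT; move: lod; rewrite /lo; case: (i) dhi => [|i'] /=; lia.
by rewrite -dE subKn.
Qed.
End StripSums.

(** * Matching the coefficients of the Pieri formula *)

Section Assembly.
Variables (n k N : nat) (lam : n.-tuple nat).
Hypothesis lam_part : is_partition lam.
Hypothesis k_gt0 : (0 < k)%N.
Hypothesis N_ge : forall l, (nth 0 lam l + k <= N)%N.
Local Notation L := (nth 0%N lam).
Local Notation T := {ffun 'I_n -> 'I_N.+1}.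

Definition tup {n N : nat} (mu : {ffun 'I_n -> 'I_N.+1}) : n.-tuple nat :=
  [tuple val (mu l) | l < n].

Lemma nth_tup (mu : T) l : nth 0%N (tup mu) l = ev mu l.
Proof.
have [ln|nl] := ltnP l n; last by rewrite nth_default ?size_tuple // /ev insubF // ltnNge nl.
by rewrite -[l]/(val (Ordinal ln)) -tnth_nth tnth_mktuple ev_ord.
Qed.

Lemma ev_nth_tup (mu : T) : nth 0%N (tup mu) = ev mu.
Proof. by apply/funext => l; rewrite nth_tup. Qed.

Definition pieri_coef (mu : n.-tuple nat) : {poly int} :=
  (- beta) ^+ (size (skew_shape mu lam) - k)
  * (-1) ^+ (k - ncols (skew_shape mu lam))
  * ('C(nrows (skew_shape mu lam) - 1, k - ncols (skew_shape mu lam)))%:R.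

Lemma power_sum_strips :
  (- beta%:MP) ^+ (sumn lam + k) * (groth_num lam * power_sum n k) =
  \sum_(mu : T) \sum_(j < n) \sum_(i < n | (i <= j)%N && (strip n L (ev mu) i j &&
                                            (ev mu i <= L j + k)%N))
    (-1) ^+ (L j + k - ev mu i) *+ 'C(j - i, L j + k - ev mu i)
    * ((- beta%:MP) ^+ sumn (tup mu) * groth_num (tup mu)).
Proof.
rewrite rowdet_groth_power_sum [RHS]exchange_big; apply: eq_bigr => j _.
rewrite (@rowdet_pieri _ _ N beta%:MP (@groth_row n)) //; first last.
- by rewrite N_ge andbT -addn1 leq_add2l.
- by move=> l; apply: leq_trans (N_ge l); rewrite leq_addr.
- by move=> l; exact: nth_partition.
- exact: groth_row_rec.
rewrite [RHS](exchange_big_dep (fun i : 'I_n => i <= j)%N); last first.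
  by move=> mu i _ /andP[].
rewrite (big_ord_widen_cond n xpredT (fun i =>
     \sum_((if i is i'.+1 then L j + k - L i' else 0) <= d < L j + k - L i)
     (-1) ^+ d *+ 'C(j - i, d) *
     \sum_(mu : T | chain L (j - i) i (L j + k - d) mu)
       rowdet (fun l => groth_row n l (ev mu l)))) //.
apply: eq_bigr => i ij; rewrite /= ltnS in ij.
rewrite sum_strip ?ij ?ltn_ord //; apply: eq_big => [//|mu _].
by rewrite -ev_nth_tup rowdet_groth.
Qed.

(** For a strip, c = mu_i - lam_j and r = j - i + 1, so the binomials agree. The maximal ribbon has
    r + c - 1 boxes: if that is below k, the binomial is 0; otherwise the factor (- beta)^(|lam| +
    k) completes the exponent |mu/lam| - k to |mu|. *)
Lemma pieri_coef_strip (mu : n.-tuple nat) i j :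
    strip n L (nth 0%N mu) i j -> (nth 0%N mu i <= L j + k)%N ->
  (if `[< pieri_set k lam mu >] then (- beta) ^+ (sumn lam + k) * pieri_coef mu else 0) =
  (-1) ^+ (L j + k - nth 0%N mu i) *+ 'C(j - i, L j + k - nth 0%N mu i) * (- beta) ^+ sumn mu.
Proof.
move=> s le; have [/andP[ij jn] lmi _ _ _] := stripP _ _ _ _ _ s.
have Lij : (L j <= L i)%N.
  elim: (j) ij {s le jn} => [|j' IH]; first by rewrite leqn0 => /eqP->.
  rewrite leq_eqVlt => /predU1P[->//|/IH]; exact: leq_trans (nth_partition _ lam_part).
have [nu [max_nu sz_nu le_nu]] := strip_max_ribbon lam_part s.
have dE : (k - ncols (skew_shape mu lam) = L j + k - nth 0%N mu i)%N.
  by rewrite (strip_ncols lam_part s); lia.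
have [big|small] := ltnP (j - i) (L j + k - nth 0%N mu i).
  rewrite bin_small // mulr0n mul0r; case: ifP => // _.
  by rewrite /pieri_coef (strip_nrows lam_part s) dE subn1 bin_small // !mulr0.
rewrite ifT; last first.
  apply/asboolP; split.
  - exact: strip_partition s.
  - exact: strip_part_le s.
  - by rewrite (strip_ncols lam_part s); lia.
  - exact: strip_connected s.
  by exists nu; split=> //; rewrite sz_nu; lia.
rewrite /pieri_coef (strip_nrows lam_part s) dE subn1 /=.
rewrite -(size_skew_shape (strip_part_le lam_part s)).
have k_le : (k <= size (skew_shape mu lam))%N.
  by rewrite (leq_trans _ le_nu) // sz_nu; lia.
have -> : (size (skew_shape mu lam) + sumn lam =
           (sumn lam + k) + (size (skew_shape mu lam) - k))%N by lia.
by rewrite [in RHS]exprD mulr_natr -mulrnAr mulrA mulrC.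
Qed.

(* Extends a coefficient identity to all of [T]: at most one strip contributes. *)
Lemma pieri_coef_sum (mu : T) :
  \sum_(j < n) \sum_(i < n | (i <= j)%N && (strip n L (ev mu) i j &&
                                            (ev mu i <= L j + k)%N))
    (-1) ^+ (L j + k - ev mu i) *+ 'C(j - i, L j + k - ev mu i)
    * (- beta) ^+ sumn (tup mu) =
  if `[< pieri_set k lam (tup mu) >]
  then (- beta) ^+ (sumn lam + k) * pieri_coef (tup mu) else 0.
Proof.
have [[[i j]] /andP[/= s le]|none] := pselect (exists p : 'I_n * 'I_n,
    strip n L (ev mu) p.1 p.2 && (ev mu p.1 <= L p.2 + k)%N).
  have [/andP[ij _] _ _ _ _] := stripP _ _ _ _ _ s.
  have uniq_s (i' j' : 'I_n) : strip n L (ev mu) i' j' -> i' = i /\ j' = j.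
    rewrite -ev_nth_tup in s *; move=> s'.
    by have [/ord_inj + /ord_inj] := strip_uniq lam_part s' s.
  rewrite (bigD1 j) //= [X in _ + X]big1 => [|j' j'j]; last first.
    rewrite big1 // => i' /and3P[_ /uniq_s[_ jE] _].
    by rewrite jE eqxx in j'j.
  rewrite addr0 (big_pred1 i) => [|i']; last first.
    rewrite /=; apply/and3P/eqP => [[_ /uniq_s[]]//|->]; by split.
  have := @pieri_coef_strip (tup mu) i j; rewrite nth_tup ev_nth_tup => ->//.
rewrite big1 => [|j _]; last first.
  rewrite big1 // => i /and3P[_ s le]; case: none.
  by exists (i, j); rewrite /= s le.
(* No strip fits, so mu must lie outside [pieri_set]: a member has at least k > 0 boxes, hence is a
   strip, and c <= k gives mu_i <= lam_j + k. *)
case: asboolP => // -[pmu lemu cmu conn [nu [[[pnu lenu lenumu _] _] k_nu]]].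
have [|i [j s]] := connected_strip lam_part pmu lemu conn.
  by rewrite (leq_trans k_gt0) // (leq_trans k_nu) // leq_size_skew_shape.
have [/andP[ij jn] _ _ _ _] := stripP _ _ _ _ _ s.
case: none; exists (Ordinal (leq_ltn_trans ij jn), Ordinal jn) => /=.
rewrite -ev_nth_tup s /=.
by rewrite (strip_ncols lam_part s) leq_subLR in cmu.
Qed.
End Assembly.


(** [tup] is injective and reaches every tuple with parts at most [N]. *)
Lemma fsbig_tup (V : nmodType) (n N : nat) (A : set (n.-tuple nat))
    (f : n.-tuple nat -> V) :
    (forall mu l, A mu -> (nth 0 mu l <= N)%N) ->
  \sum_(mu \in A) f mu =
  \sum_(mu : {ffun 'I_n -> 'I_N.+1}) if `[< A (tup mu) >] then f (tup mu) else 0.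
Proof.
move=> AN; pose tups := [seq tup mu | mu : {ffun 'I_n -> 'I_N.+1}].
have tup_inj : injective (@tup n N).
  move=> mu mu' e.
  by apply/ffunP => l; apply/val_inj; rewrite /= -!ev_ord -!nth_tup e.
rewrite (fsbigE [seq mu <- tups | `[< A mu >]]).
- rewrite big_filter_cond big_image_cond -big_mkcond; apply: eq_bigl => mu /=.
  by rewrite -[_ \in A]/(`[< A (tup mu) >]) andbb.
- by rewrite filter_uniq // map_inj_uniq // enum_uniq.
- by move=> mu /=; rewrite mem_filter => /andP[/asboolP].
move=> mu Amu; rewrite mem_filter (introT (asboolP _) Amu) => /negP[].
apply/fintype.imageP; exists [ffun l => inord (tnth mu l)] => //.
apply: eq_from_tnth => l; rewrite tnth_mktuple ffunE /= inordK //.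
by rewrite ltnS (tnth_nth 0%N); exact: AN.
Qed.

Theorem theorem1p1 (n k : nat) (n_gt0 : (0 < n)%N) (k_gt0 : (0 < k)%N)
    (lam : n.-tuple nat) (lam_part : is_partition lam) :
  grothendieck lam * power_sum n k =
  \sum_(mu \in pieri_set k lam)
     ((- beta) ^+ (size (skew_shape mu lam) - k)
      * (-1) ^+ (k - ncols (skew_shape mu lam))
      * ('C(nrows (skew_shape mu lam) - 1, k - ncols (skew_shape mu lam)))%:R)
     *: grothendieck mu.
Proof.
have [N N_ge] : exists N, forall l, (nth 0 lam l + k <= N)%N.
  exists (sumn lam + k)%N => l; rewrite leq_add2r.
  have [ln|nl] := ltnP l n; last by rewrite nth_default ?size_tuple.
  by rewrite sumnE big_tuple (bigD1 (Ordinal ln)) //= (tnth_nth 0%N) leq_addr.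
(* Parts are bounded by mu_l <= lam_l + c(mu/lam) <= lam_l + k <= N. *)
rewrite (@fsbig_tup _ _ N) => [|mu l [_ _ cmu _ _]]; last first.
  have [ln|nl] := ltnP l n; last by rewrite nth_default ?size_tuple.
  have := skew_shape_ncols mu lam (Ordinal ln); rewrite !(tnth_nth 0%N) /=.
  by move=> le; rewrite (leq_trans le) // (leq_trans _ (N_ge l)) // leq_add2l.
(* In a domain, both sides may be compared after multiplication by the Vandermonde product and,
   below, by (- beta)^(|lam| + k). *)
apply: (mulIf (vandermonde_neq0 n)); rewrite mulrAC grothendieckP [in RHS]mulr_suml.
have beta_neq0 : (- beta) ^+ (sumn lam + k) != 0.
  by rewrite expf_neq0 // oppr_eq0 polyX_eq0.
have nz : (- beta%:MP_[n]) ^+ (sumn lam + k) != 0.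
  rewrite -[X in X != 0](_ : ((- beta) ^+ (sumn lam + k))%:MP = _) ?mpolyC_eq0 //.
  by rewrite rmorphXn rmorphN.
apply: (mulfI nz); rewrite (power_sum_strips lam_part k_gt0 N_ge) mulr_sumr.
apply: eq_bigr => mu _.
(* For each mu the coefficient identity holds in Z[beta] and is carried over by the embedding of
   constants. *)
transitivity ((if `[< pieri_set k lam (tup mu) >]
  then (- beta) ^+ (sumn lam + k) * pieri_coef k lam (tup mu) else 0)%:MP * groth_num (tup mu)).
  rewrite -pieri_coef_sum // rmorph_sum mulr_suml; apply: eq_bigr => j _.
  rewrite rmorph_sum mulr_suml; apply: eq_bigr => i _.
  by rewrite rmorphM rmorphMn !rmorphXn !rmorphN rmorph1 mulrA.
case: ifP => _; last by rewrite mpolyC0 !mul0r mulr0.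
by rewrite -grothendieckP -[in RHS]mul_mpolyC rmorphM rmorphXn rmorphN !mulrA.
Qed.
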